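(* Let $(X,f)$ be a topological dynamical system and let $\varphi,\psi\in C(X,\mathbb{R})$ with $\psi>0$. Then $$P_\psi(\varphi)=\inf\{\beta\in\mathbb{R}: P(\varphi-\beta\psi)\le 0\}=\sup\{\beta\in\mathbb{R}: P(\varphi-\beta\psi)\ge 0\},$$ where $P_\psi(\varphi)$ is the $\psi$-induced topological pressure of $\varphi$ and $P(\cdot)$ is the usual topological pressure with respect to $f$ (with the convention $\inf\emptyset=\infty$).
   Context: A topological dynamical system (TDS) $(X,f)$ is a compact metric space $(X,d)$ together with a continuous map $f:X\to X$. $C(X,\mathbb{R})$ is the space of continuous real-valued functions on $X$ with the supremum norm. For $n\ge 1$, $(S_n\varphi)(x)=\sum_{i=0}^{n-1}\varphi(f^i x)$. Here $\mathbb{N}=\{1,2,\dots\}$. $P(\varphi)$ denotes the standard (Walters) topological pressure of $\varphi\in C(X,\mathbb{R})$ for $f$, with values in $(-\infty,\infty]$. For $n\in\mathbb{N}$, $d_n(x,y)=\max\{d(f^i(x),f^i(y)): i=0,\dots,n-1\}$. For $Z\subseteq X$ and $\epsilon>0$, a set $F_n\subset X$ is an $(n,\epsilon)$-spanning set of $Z$ if for every $y\in Z$ there is $x\in F_n$ with $d_n(x,y)\le\epsilon$. Induced topological pressure: let $\varphi,\psi\in C(X,\mathbb{R})$ with $\psi>0$. For $T>0$ put $$S_T=\{n\in\mathbb{N}: \exists x\in X \text{ such that } S_n\psi(x)\le T \text{ and } S_{n+1}\psi(x)>T\},$$ and for $n\in S_T$ put $X_n=\{x\in X: S_n\psi(x)\le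 T \text{ and } S_{n+1}\psi(x)>T\}$ (which depends on $T$; $S_T$ is a finite set). Let $$Q_{\psi,T}(f,\varphi,\epsilon)=\inf\Big\{\sum_{n\in S_T}\sum_{x\in F_n}\exp\big((S_n\varphi)(x)\big): F_n \text{ is an } (n,\epsilon)\text{-spanning set of } X_n \text{ for each } n\in S_T\Big\}.$$ The $\psi$-induced topological pressure of $\varphi$ (with respect to $f$) is $$P_\psi(\varphi)=\lim_{\epsilon\to0}\limsup_{T\to\infty}\frac1T\log Q_{\psi,T}(f,\varphi,\epsilon),$$ where the limit in $\epsilon$ exists (possibly $+\infty$) by monotonicity. *)

(* Defs.v *)
From mathcomp Require Import all_boot all_order all_algebra.
From mathcomp Require Import all_classical all_reals all_analysis.

Set Implicit Arguments.
Unset Strict Implicit.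
Unset Printing Implicit Defensive.

Import Order.TTheory GRing.Theory Num.Theory.
Import numFieldNormedType.Exports.

Local Open Scope classical_set_scope.
Local Open Scope ring_scope.

Section pressure.
Context {R : realType} {X : metricType R}.
Implicit Types (f : X -> X) (phi psi : X -> R) (Z F : set X) (eps T : R).

Definition birkhoff f phi (n : nat) (x : X) : R :=
  \sum_(i < n) phi (iter i f x).

(* Distances are nonnegative, so the default value 0 of the iterated maximum
   only matters when n = 0. *)
Definition bowen_dist f (n : nat) (x y : X) : R :=
  \big[Num.max/0]_(i < n) mdist (iter i f x) (iter i f y).

(* F need not be contained in Z, nor be finite. *)
Definition spanning f (n : nat) eps Z F : Prop :=
  forall y, Z y -> exists2 x, F x & bowen_dist f n x y <= eps.

(* The sum over a possibly infinite F is the unordered sum of nonnegative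
   extended reals, with value in [0, +oo]. *)
Definition exp_sum f phi (n : nat) F : \bar R :=
  (\esum_(x in F) (expR (birkhoff f phi n x))%:E)%E.

Definition pressure_Q f phi eps (n : nat) : \bar R :=
  ereal_inf [set exp_sum f phi n F | F in spanning f n eps [set: X]].

Definition pressure_eps f phi eps : \bar R :=
  limn_esup (fun n : nat => ((n%:R^-1)%:E * lne (pressure_Q f phi eps n))%E).

(* Both pressures are nonincreasing in eps > 0, hence the limits at 0^'+ below
   exist in \bar R. *)
Definition pressure f phi : \bar R :=
  lim (pressure_eps f phi eps @[eps --> 0^'+]).

Definition level_set f psi T (n : nat) : set X :=
  [set x | birkhoff f psi n x <= T /\ T < birkhoff f psi n.+1 x].

Definition level_times f psi T : set nat :=
  [set n | (0 < n)%N /\ exists x, level_set f psi T n x].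

Definition induced_Q f psi phi eps T : \bar R :=
  ereal_inf
    [set (\esum_(n in level_times f psi T) exp_sum f phi n (F n))%E
    | F in [set F : nat -> set X | forall n, level_times f psi T n ->
              spanning f n eps (level_set f psi T n) (F n)]].

Definition induced_pressure_eps f psi phi eps : \bar R :=
  limf_esup (fun T : R => ((T^-1)%:E * lne (induced_Q f psi phi eps T))%E)
    (pinfty_nbhs R).

Definition induced_pressure f psi phi : \bar R :=
  lim (induced_pressure_eps f psi phi eps @[eps --> 0^'+]).

End pressure.

(* Main.v *)
Require Import Defs.
From mathcomp Require Import all_boot all_order all_algebra.
From mathcomp Require Import all_classical all_reals all_analysis.
From mathcomp Require Import ring lra.
Set Implicit Arguments.
Unset Strict Implicit.
Unset Printing Implicit Defensive.

Import Order.TTheory GRing.Theory Num.Theory.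
Import numFieldNormedType.Exports.
Local Open Scope classical_set_scope.
Local Open Scope ring_scope.

(** Write [g_beta = phi - beta * psi], so that
    [S_n g_beta = S_n phi - beta * S_n psi].  On the level set [X_n] of time
    [T] the sum [S_n psi] is within [sup psi] of [T]; hence there
    [exp (S_n phi)] and [exp (beta T) * exp (S_n g_beta)] agree up to a bounded
    factor, and the pressure of [g_beta], which sorts orbits by their length
    [n], can be compared with the induced pressure, which sorts them by their
    [psi]-length [T].

    Both formulas follow from two implications.

    (A) If [P(g_beta) <= 0], then [P_psi(phi) <= beta]
    ([induced_pressure_le_of_pressure_le0]).  Take for each large [n] a
    spanning set of [X] for [g_beta] whose exponential sum is at most
    [exp (delta n)].  Used for the level sets of time [T], these sets give a
    total of at most [exp (beta T) * sum_n exp (delta n)] up to a bounded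
    factor; as [n <= T / inf psi] on a level set, [exp (delta n)] is at most
    [exp (eta T / 2) * exp (- delta n)] for [delta = eta * inf psi / 4], and
    the sum over [n] is bounded by a geometric series.

    (B) If [P_psi(phi) < beta], then [P(g_beta) < 0]
    ([pressure_lt0_of_induced_pressure_lt]).  Put [m = inf psi].  For fixed [n]
    the level sets of the times [T = k m] cover [X], because
    [S_(n+1) psi >= S_n psi + m].  Spanning sets that nearly realize the
    induced pressure at these times therefore combine into one spanning set
    of [X], and its exponential sum for [g_beta] is at most a constant times
    [sum_k exp (- 2 eta k m)], where only [k >= n] contribute: it decays like
    [exp (- eta m n)].

    The points of a spanning set of [X_n] need not lie in [X_n].  Points at
    Bowen distance more than [e] from [X_n] are discarded ([trim]); at the
    others uniform continuity of [psi] gives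
    [|S_n psi - T| <= sup psi + n w] ([trim_birkhoff]), where [w] is the
    oscillation of [psi] at scale [e].  Since [n <= T / m], this error costs
    at most [|beta| w / m] in the growth rate in [T], and [w] tends to 0 with
    [e]. *)

(** * Exponential growth rates in the extended reals *)

Section growth_rate.
Context {R : realType}.
Local Open Scope ereal_scope.

Lemma le_lne (x y : \bar R) : x <= y -> lne x <= lne y.
Proof.
move=> xy; have [/le0_lneNy ->|x0] := leP x 0; first by rewrite leNye.
by rewrite lee_lne// in_itv/= leey andbT ltW// (lt_le_trans x0).
Qed.

Lemma lne_le (x : \bar R) (r : R) : x <= (expR r)%:E -> lne x <= r%:E.
Proof. by move=> /le_lne; rewrite lne_EFin ?expR_gt0// expRK. Qed.

Lemma lne_lt (x : \bar R) (r : R) : lne x < r%:E -> x < (expR r)%:E.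
Proof.
rewrite !ltNge; apply: contra => /le_lne.
by rewrite lne_EFin ?expR_gt0// expRK.
Qed.

Lemma lte_dense_EFin (x y : \bar R) : x < y -> exists2 r : R, x < r%:E & r%:E < y.
Proof.
case: x y => [x| |] [y| |]//=; rewrite ?lte_fin => xy.
- by exists ((x + y) / 2)%R; rewrite lte_fin; lra.
- by exists (x + 1)%R; rewrite ?ltry// lte_fin; lra.
- by exists (y - 1)%R; rewrite ?ltNyr// lte_fin; lra.
- by exists 0%R; rewrite ?ltNyr ?ltry.
Qed.

Context {T : choiceType} {I : filteredType T} {F : set_system I} {FF : Filter F}.

Lemma le_limf_esup (u v : I -> \bar R) :
  (\forall i \near F, u i <= v i) -> limf_esup u F <= limf_esup v F.
Proof.
move=> uv; apply: le_ereal_inf_tmp => _ [V FV <-].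
apply: ge_ereal_inf; exists (ereal_sup (u @` (V `&` [set i | u i <= v i]))).
  by exists (V `&` [set i | u i <= v i]) => //; exact: filterI.
apply: ge_ereal_sup => _ [i [Vi uvi] <-].
by apply: le_trans uvi _; apply: ereal_sup_ubound; exists i.
Qed.

Lemma limf_esup_le (u : I -> \bar R) (c : \bar R) :
  (\forall i \near F, u i <= c) -> limf_esup u F <= c.
Proof.
move=> uc; apply: ge_ereal_inf; exists (ereal_sup (u @` [set i | u i <= c])).
  by exists [set i | u i <= c].
by apply: ge_ereal_sup => _ [i ? <-].
Qed.

Lemma limf_esup_lt (u : I -> \bar R) (c : \bar R) :
  limf_esup u F < c -> \forall i \near F, u i < c.
Proof.
move=> /ereal_inf_lt[_ [V FV <-] Vc]; apply: filterS FV => i Vi.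
by apply: le_lt_trans Vc; apply: ereal_sup_ubound; exists i.
Qed.

(* Both pressures are upper limits of [(1 / s) * lne Q], with [s] the length [n]
   or the time [T]. *)
Variables (s : I -> R) (Q : I -> \bar R).
Hypothesis s_infty : forall b : R, \forall i \near F, (b < s i)%R.

Lemma growth_rate_lt (c : R) :
  limf_esup (fun i => (s i)^-1%:E * lne (Q i)) F < c%:E ->
  \forall i \near F, Q i < (expR (c * s i))%:E.
Proof.
move=> /limf_esup_lt; apply: filterS2 (s_infty 0%R) => i s0 uc.
apply: lne_lt; rewrite EFinM muleC -lte_pdivrMl//.
Qed.

(** The constant [C] disappears since [ln C / s i] tends to 0. *)
Lemma growth_rate_le (C a : R) : (0 < C)%R ->
  (\forall i \near F, Q i <= (C * expR (a * s i))%:E) ->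
  limf_esup (fun i => (s i)^-1%:E * lne (Q i)) F <= a%:E.
Proof.
move=> C0 QC; apply/lee_addgt0Pr => e e0; apply: limf_esup_le.
apply: filterS3 QC (s_infty 0%R) (s_infty (ln C / e)%R) => i Qi s0 se.
rewrite lee_pdivrMl//; apply: lne_le; apply: le_trans Qi _.
rewrite lee_fin -[X in (X * _)%R](lnK (x := C)) ?posrE// -expRD ler_expR.
by move: se; rewrite ltr_pdivrMr// mulrDr; lra.
Qed.

End growth_rate.

(** * Right limits of nonincreasing functions *)

Section right_limit.
Context {R : realType}.
Local Open Scope ereal_scope.
Variable h : R -> \bar R.
Hypothesis h_anti : forall e e' : R, (0 < e)%R -> (e <= e')%R -> h e' <= h e.

Lemma lim_right_nonincreasing :
  lim (h e @[e --> 0^'+]) = ereal_sup (h @` `]0%R, +oo[).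
Proof.
apply: cvg_lim => //.
apply: nonincreasing_at_right_cvge; first by rewrite bnd_simp.
move=> e e'; rewrite !in_itv/= !andbT => e0 _; exact: h_anti.
Qed.

Lemma le_lim_right (e : R) : (0 < e)%R -> h e <= lim (h e @[e --> 0^'+]).
Proof.
move=> e0; rewrite lim_right_nonincreasing; apply: ereal_sup_ubound.
by exists e => //=; rewrite in_itv/= e0.
Qed.

Lemma lim_right_le (d : R) (c : \bar R) : (0 < d)%R ->
  (forall e : R, (0 < e)%R -> (e <= d)%R -> h e <= c) ->
  lim (h e @[e --> 0^'+]) <= c.
Proof.
move=> d0 hc; rewrite lim_right_nonincreasing; apply: ge_ereal_sup => x [e /=].
rewrite in_itv/= andbT => e0 <-; have [ed|/ltW de] := leP e d; first exact: hc.
by apply: le_trans (h_anti d0 de) _; exact: hc.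
Qed.

End right_limit.

(** * Sums of nonnegative extended reals *)

Section sums.
Context {R : realType}.
Local Open Scope ereal_scope.

Lemma subset_esum (T : choiceType) (A B : set T) (a : T -> \bar R) :
  A `<=` B -> \esum_(x in A) a x <= \esum_(x in B) a x.
Proof.
move=> AB; apply: ereal_sup_le; apply: image_subset => Y [finY YA].
by split=> //; apply: subset_trans AB.
Qed.

(** Made disjoint, the sets have the same union and only get smaller. *)
Lemma esum_bigcup_le (T : choiceType) (F : nat -> set T) (a : T -> \bar R) :
  (forall x, 0 <= a x) ->
  \esum_(x in \bigcup_k F k) a x <= \esum_(k in [set: nat]) \esum_(x in F k) a x.
Proof.
move=> a0; rewrite seqDU_bigcup_eq esum_bigcupT//.
by apply: le_esum => k _; apply: subset_esum; exact: subset_seqDU.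
Qed.

Lemma esum_geometric_le (A : set nat) (a : nat -> \bar R) (c q : R) :
  (0 <= c)%R -> (0 < q < 1)%R ->
  (forall n, A n -> a n <= (c * q ^+ n)%:E) ->
  \esum_(n in A) a n <= (c / (1 - q))%:E.
Proof.
move=> c0 /andP[q0 q1] ac; apply: (le_trans (le_esum ac)).
have cq0 n : (0 <= c * q ^+ n)%R by rewrite mulr_ge0// exprn_ge0// ltW.
apply: (le_trans (@subset_esum _ _ [set: nat] _ _)) => //.
rewrite -nneseries_esumT; last by move=> n; rewrite lee_fin.
apply: lime_le; first by apply: is_cvg_nneseries => n _ _; rewrite lee_fin.
apply: nearW => n; rewrite sumEFin lee_fin; apply: geometric_le_lim => //.
by rewrite ger0_norm// ltW.
Qed.

End sums.

(** * Spanning sets and exponential sums *)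

Section trimming.
Context {R : realType} {X : metricType R}.
Variable f : X -> X.
Implicit Types (phi psi g h : X -> R) (F Z : set X).

Lemma spanning_weaken n (e e' : R) Z F :
  e <= e' -> spanning f n e Z F -> spanning f n e' Z F.
Proof.
by move=> ee' FZ y /FZ[x Fx xy]; exists x => //; exact: le_trans ee'.
Qed.

Lemma pressure_eps_anti phi (e e' : R) : e <= e' ->
  (pressure_eps f phi e' <= pressure_eps f phi e)%E.
Proof.
move=> ee'; apply: le_limf_esup; apply: nearW => n.
apply: lee_wpmul2l; first by rewrite lee_fin invr_ge0.
apply: le_lne; apply: ereal_inf_le_tmp; apply: image_subset => F.
exact: spanning_weaken.
Qed.

Lemma induced_pressure_eps_anti psi phi (e e' : R) : e <= e' ->
  (induced_pressure_eps f psi phi e' <= induced_pressure_eps f psi phi e)%E.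
Proof.
move=> ee'; apply: le_limf_esup.
apply: filterS (nbhs_pinfty_gt (num_real 0)) => T T0.
apply: lee_wpmul2l; first by rewrite lee_fin invr_ge0 ltW.
apply: le_lne; apply: ereal_inf_le_tmp; apply: image_subset => F /= FT n /FT.
exact: spanning_weaken.
Qed.

Lemma exp_sum_ge0 phi n F : (0 <= exp_sum f phi n F)%E.
Proof. by apply: esum_ge0 => x _; rewrite lee_fin expR_ge0. Qed.

Lemma exp_sum_le g h n (a c : R) F F' : F `<=` F' ->
  (forall x, F x -> birkhoff f h n x <= birkhoff f g n x + a) ->
  (exp_sum f g n F' <= c%:E)%E ->
  (exp_sum f h n F <= (expR a * c)%:E)%E.
Proof.
move=> FF' hg gc; apply: ge_ereal_sup => _ [Y [finY YF] <-].
apply: (@le_trans _ _ ((expR a)%:E * \sum_(x \in Y) (expR (birkhoff f g n x))%:E)%E).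
  rewrite ge0_mule_fsumr//.
  apply: lee_fsum => // x /YF Fx; rewrite -EFinM -expRD lee_fin ler_expR.
  by rewrite addrC; exact: hg.
rewrite EFinM; apply: lee_wpmul2l; first by rewrite lee_fin expR_ge0.
apply: le_trans gc; apply: ereal_sup_ubound; exists Y => //.
by split=> //; exact: subset_trans FF'.
Qed.

(** A trimmed set spans as much of [Z], but its points also shadow points of
    [Z], so that Birkhoff sums at them are controlled by those on [Z]. *)
Definition trim n (e : R) Z F : set X :=
  [set x | F x /\ exists2 y, Z y & bowen_dist f n x y <= e].

Lemma trim_sub n e Z F : trim n e Z F `<=` F.
Proof. by move=> x []. Qed.

Lemma spanning_trim n e Z F :
  spanning f n e Z F -> spanning f n e Z (trim n e Z F).
Proof.
move=> FZ y Zy; have [x Fx xy] := FZ y Zy.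
by exists x => //; split=> //; exists y.
Qed.

Lemma birkhoffB phi psi (beta : R) n x :
  birkhoff f (fun x => phi x - beta * psi x) n x =
  birkhoff f phi n x - beta * birkhoff f psi n x.
Proof. by rewrite /birkhoff sumrB mulr_sumr. Qed.

End trimming.

(** * Birkhoff sums near a level set *)

Section distortion.
Context {R : realType} {X : metricType R}.
Variables (f : X -> X) (psi : X -> R).

(** On the empty space, [0 < M] does not follow from the other two bounds. *)
Lemma positive_bounds : compact [set: X] -> continuous psi ->
  (forall x, 0 < psi x) ->
  exists m M : R, [/\ 0 < m, 0 < M & forall x, m <= psi x <= M].
Proof.
move=> cX cpsi psi0; have [[x0 _]|/nonemptyPn X0] := pselect ([set: X] !=set0).
  have psiW : {within [set: X], continuous psi}.
    exact: continuous_subspaceT.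
  have [a _ psia] := compact_EVT_min (ex_intro _ x0 I) cX psiW.
  have [b _ psib] := compact_EVT_max (ex_intro _ x0 I) cX psiW.
  by exists (psi a), (psi b); split => // x; rewrite psia ?psib ?inE.
by exists 1, 1; split=> // x; have : [set: X] x by []; rewrite X0.
Qed.

Lemma uniform_modulus (w : R) : compact [set: X] -> continuous psi -> 0 < w ->
  exists2 d : R, 0 < d & forall x y, mdist x y <= d -> `|psi x - psi y| <= w.
Proof.
move=> /compact_near_coveringP cX cpsi w0.
pose P (e : R) x := forall y, mdist x y <= e -> `|psi x - psi y| <= w.
suff : \forall e \near 0^'+, [set: X] `<=` P e.
  move=> /(filterI (nbhs_right_gt 0)) /filter_ex[d [d0 Pd]].
  by exists d => // x; exact: Pd.
apply: cX => x _.
have : \forall y \near x, `|psi x - psi y| <= w / 2.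
  by have /cvgrPdist_le := cpsi x; apply; rewrite divr_gt0.
move=> /nbhs_ballP[r /= r0 xr].
exists (ball x (r / 2), [set e | e < r / 2]) => /=.
  split; first by apply: nbhsx_ballx; rewrite divr_gt0.
  by apply: nbhs_right_lt; rewrite divr_gt0.
move=> [x' e] /= [xx' er] y x'y.
have xy : ball x r y.
  rewrite [r]splitr; apply: ball_triangle xx' _.
  by rewrite ballEmdist /=; exact: le_lt_trans er.
have xx'r : ball x r x' by apply: le_ball xx'; rewrite ler_pdivrMr//; lra.
have := xr _ xy; have := xr _ xx'r => /=.
by rewrite !ler_norml; lra.
Qed.

Variables (m M e w : R).
Hypothesis m_gt0 : 0 < m.
Hypothesis psi_bounds : forall x, m <= psi x <= M.

Lemma birkhoffSr phi n x :
  birkhoff f phi n.+1 x = birkhoff f phi n x + phi (iter n f x).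
Proof. by rewrite /birkhoff big_ord_recr. Qed.

Lemma birkhoff_ge n x : n%:R * m <= birkhoff f psi n x.
Proof.
rewrite mulr_natl -[n in leLHS]card_ord -sumr_const; apply: ler_sum => i _.
by have /andP[] := psi_bounds (iter i f x).
Qed.

Lemma birkhoff_le n x : birkhoff f psi n x <= n%:R * M.
Proof.
rewrite mulr_natl -[n in leRHS]card_ord -sumr_const; apply: ler_sum => i _.
by have /andP[] := psi_bounds (iter i f x).
Qed.

Lemma level_set_bounds (T : R) n y : level_set f psi T n y ->
  n%:R * m <= T /\ T < n.+1%:R * M.
Proof.
move=> [yT Ty]; split; first exact: le_trans (birkhoff_ge n y) yT.
exact: lt_le_trans Ty (birkhoff_le n.+1 y).
Qed.

(** The sums [S_n psi y] and [S_(n+1) psi y] differ by at least [m], so a multiple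
    of [m] falls between them.  Discrete times [k m] thus suffice to cover the
    space by level sets with the same [n]. *)
Lemma exists_level_set n y :
  exists k : nat, level_set f psi (k%:R * m) n y.
Proof.
have ex_k : exists k : nat, birkhoff f psi n y <= k%:R * m.
  exists (Num.truncn (birkhoff f psi n y / m)).+1.
  by rewrite -ler_pdivrMr// ltW// truncnS_gt.
(* The least such [k]: its predecessor lies strictly below [S_n psi y]. *)
have [k Sk kmin] := ex_minnP ex_k; exists k; split=> //.
have /andP[m_psi _] := psi_bounds (iter n f y); rewrite birkhoffSr.
case: k Sk kmin => [|k] Sk kmin.
  rewrite mul0r; apply: ltr_wpDl (lt_le_trans m_gt0 m_psi).
  by apply: le_trans (birkhoff_ge n y); rewrite mulr_ge0// ltW.
have : k%:R * m < birkhoff f psi n y.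
  by rewrite ltNge; apply/negP => /kmin; rewrite ltnn.
by rewrite -natr1; lra.
Qed.

Hypothesis psi_modulus : forall x y, mdist x y <= e -> `|psi x - psi y| <= w.

Lemma birkhoff_modulus n x y : bowen_dist f n x y <= e ->
  `|birkhoff f psi n x - birkhoff f psi n y| <= n%:R * w.
Proof.
move=> xy; rewrite /birkhoff -sumrB; apply: le_trans (ler_norm_sum _ _ _) _.
rewrite mulr_natl -[n in leRHS]card_ord -sumr_const; apply: ler_sum => i _.
by apply: psi_modulus; apply: le_trans xy; exact: le_bigmax.
Qed.

(** A point [y] of the level set has [T - M < S_n psi y <= T] and [n m <= T];
    moving from [y] to [x] costs at most [n w <= w / m * T]. *)
Lemma trim_birkhoff (T : R) n F x : 0 <= w ->
  trim f n e (level_set f psi T n) F x ->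
  `|birkhoff f psi n x - T| <= M + w / m * T.
Proof.
move=> w0 [_ [y Ty /birkhoff_modulus xy]].
have [nT _] := level_set_bounds Ty.
have nw : n%:R * w <= w / m * T.
  by rewrite mulrAC ler_pdivlMr// mulrAC mulrC ler_wpM2l.
have [yT] := Ty; rewrite birkhoffSr => Ty'.
have /andP[_ psiM] := psi_bounds (iter n f y).
by move: xy; rewrite !ler_norml; lra.
Qed.

Variables (phi : X -> R) (beta : R).

(** Near a level set of time [T], replacing [S_n psi] by [T] turns the weight of
    [phi - beta * psi] into that of [phi] times [expR (beta * T)], up to the error
    of [trim_birkhoff]; [exp_sum_trim_sub] is the converse passage. *)
Lemma exp_sum_trim_add (T c : R) n F : 0 <= w ->
  (exp_sum f (fun x => phi x - beta * psi x)%R n F <= c%:E)%E ->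
  (exp_sum f phi n (trim f n e (level_set f psi T n) F) <=
    (expR (beta * T + `|beta| * (M + w / m * T)) * c)%R%:E)%E.
Proof.
move=> w0; apply: exp_sum_le; first exact: trim_sub.
move=> x /(trim_birkhoff w0) xT; rewrite birkhoffB.
have : beta * (birkhoff f psi n x - T) <= `|beta| * (M + w / m * T).
  by apply: le_trans (ler_norm _) _; rewrite normrM ler_wpM2l.
lra.
Qed.

Lemma exp_sum_trim_sub (T c : R) n F : 0 <= w ->
  (exp_sum f phi n F <= c%:E)%E ->
  (exp_sum f (fun x => phi x - beta * psi x)%R n
     (trim f n e (level_set f psi T n) F) <=
    (expR (- (beta * T) + `|beta| * (M + w / m * T)) * c)%R%:E)%E.
Proof.
move=> w0; apply: exp_sum_le; first exact: trim_sub.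
move=> x /(trim_birkhoff w0) xT; rewrite birkhoffB.
have : - beta * (birkhoff f psi n x - T) <= `|beta| * (M + w / m * T).
  by apply: le_trans (ler_norm _) _; rewrite normrM normrN ler_wpM2l.
lra.
Qed.

End distortion.

(** * Comparing the two pressures *)

Section comparison.
Context {R : realType} {X : metricType R}.
Variables (f : X -> X) (phi psi : X -> R).
Hypothesis X_compact : compact [set: X].
Hypothesis psi_cont : continuous psi.
Hypothesis psi_gt0 : forall x, 0 < psi x.

Local Notation shifted beta := (fun x => phi x - beta * psi x)%R.

Lemma small_modulus (beta eta m : R) : 0 < eta -> 0 < m ->
  exists2 w : R, 0 < w & `|beta| * (w / m) <= eta.
Proof.
move=> eta0 m0; exists (eta * m / (`|beta| + 1)).
  by rewrite divr_gt0 ?mulr_gt0// ltr_wpDl.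
have b1 : 0 < `|beta| + 1 by rewrite ltr_wpDl.
rewrite [X in _ * X](_ : _ = eta / (`|beta| + 1)); last first.
  by field; rewrite !gt_eqF.
by rewrite mulrCA ler_piMr// ?(ltW eta0)// ler_pdivrMr//; lra.
Qed.

(** Spanning sets for the potential [phi - beta * psi], one for each [n], are
    trimmed to the level sets of every large time [T]. *)
Lemma induced_pressure_le_of_pressure_le0 (beta : R) :
  (pressure f (shifted beta) <= 0)%E -> (induced_pressure f psi phi <= beta%:E)%E.
Proof.
move=> P0.
have [m [M [m0 M0 psi_b]]] := positive_bounds X_compact psi_cont psi_gt0.
apply/lee_addgt0Pr => eta eta0.
have [w w0 w_eta] := small_modulus beta (divr_gt0 eta0 (ltr0Sn R 1)) m0.
have [d d0 psi_d] := uniform_modulus X_compact psi_cont w0.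
(* Half of [eta] absorbs the oscillation of [psi]; the other half is
   [2 delta / m], which pays for [exp (2 delta n)] as [n <= T / m]. *)
pose delta := eta * m / 4.
have delta0 : 0 < delta by rewrite divr_gt0// mulr_gt0.
apply: (@lim_right_le _ _ _ d) => // [e e' _|e e0 ed].
  exact: induced_pressure_eps_anti.
have psi_e x y : mdist x y <= e -> `|psi x - psi y| <= w.
  by move=> xy; apply: psi_d; exact: le_trans ed.
have [N _ QN] : \forall n \near \oo,
    (pressure_Q f (shifted beta) e n < (expR (delta * n%:R))%:E)%E.
  apply: (growth_rate_lt (s := fun n => n%:R)); first exact: nbhs_infty_gtr.
  apply: le_lt_trans (_ : 0 < delta%:E)%E; last by rewrite lte_fin.
  apply: le_trans P0; apply: (le_lim_right _ e0) => ? ? _.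
  exact: pressure_eps_anti.
have /choice[F FN] : forall n, exists F : set X, (N <= n)%N ->
    spanning f n e [set: X] F /\
    (exp_sum f (shifted beta) n F <= (expR (delta * n%:R))%:E)%E.
  move=> n; have [Nn|_] := leqP N n; last by exists set0.
  have /ereal_inf_lt[_ [F FX <-] /ltW FQ] := QN n Nn.
  by exists F.
pose C := expR (`|beta| * M) / (1 - expR (- delta)).
have q_lt1 : expR (- delta) < 1 by rewrite -expR0 ltr_expR; lra.
apply: (growth_rate_le (s := id) _ (C := C)).
- by move=> b; apply: nbhs_pinfty_gt; exact: num_real.
- by rewrite divr_gt0 ?expR_gt0// subr_gt0.
apply: filterS (nbhs_pinfty_gt (num_real (N.+1%:R * M))) => T TN.
(* A long time forces a long orbit, since [T < (n + 1) M]. *)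
have N_level n y : level_set f psi T n y -> (N <= n)%N.
  move=> /(level_set_bounds psi_b)[_ Tn].
  have := lt_trans TN Tn; rewrite ltr_pM2r// ltr_nat ltnS; exact: ltnW.
pose G n := trim f n e (level_set f psi T n) (F n).
apply: (@le_trans _ _ (\esum_(n in level_times f psi T) exp_sum f phi n (G n))%E).
  apply: ereal_inf_lbound; exists G => // n [_ [y /N_level Nn]].
  apply: spanning_trim => z Tz; have [FX _] := FN n Nn; exact: FX.
rewrite [X in (_ <= X%:E)%E](_ : _ =
    expR ((beta + eta) * T + `|beta| * M) / (1 - expR (- delta))).
  apply: esum_geometric_le; rewrite ?expR_ge0 ?expR_gt0//.
  move=> n [_ [y Ty]]; have [_ Fc] := FN n (N_level _ _ Ty).
  have := exp_sum_trim_add m0 psi_b psi_e T (ltW w0) Fc.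
  move=> /le_trans; apply; rewrite lee_fin -expRM_natr -!expRD ler_expR.
  have [nT _] := level_set_bounds psi_b Ty.
  have T0 : 0 <= T by apply: le_trans nT; rewrite mulr_ge0// ltW.
  have := ler_wpM2r T0 w_eta.
  have := ler_wpM2l (ltW eta0) nT; rewrite /delta.
  lra.
by rewrite expRD /C; lra.
Qed.

(** Spanning sets for the induced pressure at the times [k m], trimmed to the
    level sets with a fixed [n], are united over [k].  The gap [beta - P_psi]
    is split into three parts [eta]: one absorbs the oscillation of [psi], one
    gives decay in [n] (and so a strictly negative pressure), and one makes
    the sum over [k] converge. *)
Lemma pressure_lt0_of_induced_pressure_lt (beta : R) :
  (induced_pressure f psi phi < beta%:E)%E -> (pressure f (shifted beta) < 0)%E.
Proof.
have [m [M [m0 M0 psi_b]]] := positive_bounds X_compact psi_cont psi_gt0.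
move=> Pbeta; have [eta eta0 Peta] : exists2 eta : R, 0 < eta &
    (induced_pressure f psi phi < (beta - 3 * eta)%:E)%E.
  move: Pbeta; case: (induced_pressure _ _ _) => [r| |] //.
    rewrite lte_fin => rb; exists ((beta - r) / 4); first lra.
    by rewrite lte_fin; lra.
  by exists 1 => //; rewrite ltNyr.
have [w w0 w_eta] := small_modulus beta eta0 m0.
have [d d0 psi_d] := uniform_modulus X_compact psi_cont w0.
apply: (@le_lt_trans _ _ (- (eta * m))%:E); last by rewrite lte_fin oppr_lt0 mulr_gt0.
apply: (@lim_right_le _ _ _ d) => // [e e' _|e e0 ed]; first exact: pressure_eps_anti.
have psi_e x y : mdist x y <= e -> `|psi x - psi y| <= w.
  by move=> xy; apply: psi_d; exact: le_trans ed.
have [T0 [_ QT]] : \forall T \near +oo,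
    (induced_Q f psi phi e T < (expR ((beta - 3 * eta) * T))%:E)%E.
  apply: (growth_rate_lt (s := id)).
    by move=> b; apply: nbhs_pinfty_gt; exact: num_real.
  apply: le_lt_trans Peta; apply: (le_lim_right _ e0).
  by move=> ? ? _; exact: induced_pressure_eps_anti.
have /choice[F FT] : forall T, exists F : nat -> set X, T0 < T ->
    (forall n, level_times f psi T n ->
       spanning f n e (level_set f psi T n) (F n)) /\
    (\esum_(n in level_times f psi T) exp_sum f phi n (F n) <=
      (expR ((beta - 3 * eta) * T))%:E)%E.
  move=> T; have [T0T|_] := ltP T0 T; last by exists (fun=> set0).
  have /ereal_inf_lt[_ [F FX <-] /ltW FQ] := QT T T0T.
  by exists F.
have q_lt1 : expR (- (eta * m)) < 1 by rewrite -expR0 ltr_expR oppr_lt0 mulr_gt0.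
pose C := expR (`|beta| * M) / (1 - expR (- (eta * m))).
apply: (growth_rate_le (s := fun n => n%:R) _ (C := C)); first exact: nbhs_infty_gtr.
  by rewrite divr_gt0 ?expR_gt0// subr_gt0.
apply: filterS2 (nbhs_infty_gtr (T0 / m)) (nbhs_infty_ge 1) => n.
rewrite ltr_pdivrMr// => T0n n_gt0.
pose G k := trim f n e (level_set f psi (k%:R * m) n) (F (k%:R * m) n).
have level_k k y : level_set f psi (k%:R * m) n y ->
    [/\ n%:R * m <= k%:R * m, T0 < k%:R * m & level_times f psi (k%:R * m) n].
  move=> ky; have [nk _] := level_set_bounds psi_b ky.
  by split=> //; [exact: lt_le_trans nk|split=> //; exists y].
apply: (@le_trans _ _ (exp_sum f (shifted beta) n (\bigcup_k G k))).
  apply: ereal_inf_lbound; exists (\bigcup_k G k) => // y _.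
  have [k ky] := exists_level_set f m0 psi_b n y.
  have [_ T0k kn] := level_k k y ky.
  have [/(_ n kn)/spanning_trim /(_ y ky)[x Gx xy] _] := FT _ T0k.
  by exists x => //; exists k.
apply: le_trans (esum_bigcup_le _ _) _; first by move=> x; rewrite lee_fin expR_ge0.
rewrite [X in (_ <= X%:E)%E](_ : _ =
    expR (- (eta * m) * n%:R + `|beta| * M) / (1 - expR (- (eta * m)))).
  apply: esum_geometric_le; rewrite ?expR_ge0 ?expR_gt0//.
  (* For small [k] the level set, hence [G k], is empty; otherwise [k >= n]. *)
  move=> k _; have [[x [_ [y ky _]]]|/nonemptyPn ->] := pselect (G k !=set0).
    have [nk T0k kn] := level_k k y ky; have [_ Fk] := FT _ T0k.
    have Fkn : (exp_sum f phi n (F (k%:R * m)%R n) <=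
        (expR ((beta - 3 * eta) * (k%:R * m)))%:E)%E.
      apply: le_trans Fk.
      rewrite -(@esum_set1 _ _ n (fun n => exp_sum f phi n (F (k%:R * m) n))).
        by apply: subset_esum => _ ->.
      exact: exp_sum_ge0.
    have := exp_sum_trim_sub m0 psi_b psi_e beta (k%:R * m) (ltW w0) Fkn.
    move=> /le_trans; apply; rewrite lee_fin -expRM_natr -!expRD ler_expR.
    have km0 : 0 <= k%:R * m by rewrite mulr_ge0// ltW.
    have := ler_wpM2r km0 w_eta.
    have := ler_wpM2l (ltW eta0) nk.
    lra.
  by rewrite esum_set0 lee_fin mulr_ge0 ?exprn_ge0 ?expR_ge0.
by rewrite expRD /C; lra.
Qed.

End comparison.

Theorem corollary3p2 (R : realType) (X : metricType R) (f : X -> X)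
    (phi psi : X -> R)
    (X_compact : compact [set: X]) (f_cont : continuous f)
    (phi_cont : continuous phi) (psi_cont : continuous psi)
    (psi_gt0 : forall x, 0 < psi x) :
  induced_pressure f psi phi =
    ereal_inf [set beta%:E | beta in
      [set beta : R | (pressure f (fun x => phi x - beta * psi x)%R <= 0)%E]]
  /\
  induced_pressure f psi phi =
    ereal_sup [set beta%:E | beta in
      [set beta : R | (0 <= pressure f (fun x => phi x - beta * psi x)%R)%E]].
Proof.
have le_beta := @induced_pressure_le_of_pressure_le0
  _ _ f phi psi X_compact psi_cont psi_gt0.
have lt_beta := @pressure_lt0_of_induced_pressure_lt
  _ _ f phi psi X_compact psi_cont psi_gt0.
split; apply/eqP; rewrite eq_le; apply/andP; split.
- by apply: le_ereal_inf_tmp => _ [beta /= P0 <-]; exact: le_beta.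
- rewrite leNgt; apply/negP => /lte_dense_EFin[b Pb].
  rewrite ltNge => /negP; apply; apply: ereal_inf_lbound.
  by exists b => //=; exact/ltW/lt_beta.
- rewrite leNgt; apply/negP => /lte_dense_EFin[b + bP].
  rewrite ltNge => /negP; apply; apply: ereal_sup_ubound.
  exists b => //=; rewrite leNgt; apply/negP => /ltW/le_beta.
  by rewrite leNgt bP.
- apply: ge_ereal_sup => _ [beta /= P0 <-]; rewrite leNgt; apply/negP => /lt_beta.
  by rewrite ltNge P0.
Qed.
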